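(* Let $f=\frac1n\sum_{i=1}^n f_i$ where each $f_i:\mathbb{R}^d\to\mathbb{R}$ is convex and $L_i$-smooth, assume that $f$ is $\mu$-strongly convex ($\mu>0$) with minimizer $x^*$, and let $L_{\max}=\max_{1\le i\le n}L_i$. Then SGD with $\text{SPS}_{\max}$ with $c=1/2$ and $0<\gamma_b\le\frac{1}{L_{\max}}$ becomes SGD with constant step-size $\gamma_k=\gamma:=\gamma_b\le\frac1{L_{\max}}$, and its iterates satisfy, for all $k\ge0$, $$\mathbb{E}\|x^{k}-x^*\|^2\le(1-\mu\gamma)^k\|x^0-x^*\|^2+\frac{2\sigma^2}{\mu}.$$ If in addition interpolation holds ($\sigma=0$), the iterates of SGD with constant step-size $\gamma\le\frac1{L_{\max}}$ satisfy $$\mathbb{E}\|x^{k}-x^*\|^2\le(1-\mu\gamma)^k\|x^0-x^*\|^2.$$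
   Context: Setting: $f(x)=\frac1n\sum_{i=1}^n f_i(x)$ is minimized over $\mathbb{R}^d$, and the set $\mathcal{X}^*$ of minimizers of $f$ is nonempty. A function is $L$-smooth if it is differentiable with $L$-Lipschitz gradient. For each $i$, $f_i^*:=\inf_x f_i(x)$, and it is assumed throughout that $\sigma^2:=\mathbb{E}_i[f_i(x^* )-f_i^*]=f(x^* )-\frac1n\sum_{i=1}^n f_i^*<\infty$ (so all $f_i^*$ are finite), where $x^*\in\mathcal{X}^*$. SGD: starting from a deterministic $x^0$, at each iteration $k$ an index $i\in\{1,\dots,n\}$ is drawn uniformly at random, independently of the past, and $x^{k+1}=x^k-\gamma_k\nabla f_i(x^k)$. $\text{SPS}_{\max}$ with parameters $c>0$ and $\gamma_b>0$: $\gamma_k=\min\left\{\frac{f_i(x^k)-f_i^*}{c\|\nabla f_i(x^k)\|^2},\gamma_b\right\}$, where $i$ is the index drawn at iteration $k$. If $\nabla f_i(x^k)=0$ then $x^{k+1}=x^k$ (so any value, e.g. $\gamma_b$, may be assigned to $\gamma_k$). *)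

(* Defs.v *)
From HB Require Import structures.
From mathcomp Require Import all_boot all_order all_algebra.
From mathcomp Require Import finmap.
From mathcomp Require Import all_classical all_reals all_analysis.

Set Implicit Arguments.
Unset Strict Implicit.
Unset Printing Implicit Defensive.

Import Order.TTheory GRing.Theory Num.Theory.
Import numFieldNormedType.Exports.

Local Open Scope classical_set_scope.
Local Open Scope ring_scope.

(* The library's norm on 'rV[R]_d is the sup norm, hence a separate Euclidean
   norm. The two induce the same topology, so [differentiable] and the
   directional derivatives 'D_v f do not depend on the choice. *)
Definition enorm {R : realType} {d : nat} (x : 'rV[R]_d) : R :=
  Num.sqrt (\sum_j x 0 j ^+ 2).

Definition grad {R : realType} {d : nat} (f : 'rV[R]_d -> R) (x : 'rV[R]_d) :
    'rV[R]_d :=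
  \row_j 'D_(delta_mx 0 j) f x.

Definition smooth {R : realType} {d : nat} (L : R) (f : 'rV[R]_d -> R) : Prop :=
  (forall x, differentiable f x) /\
  (forall x y, enorm (grad f x - grad f y) <= L * enorm (x - y)).

Definition strongly_convex {R : realType} {d : nat} (mu : R)
    (f : 'rV[R]_d -> R) : Prop :=
  forall (t : R) (x y : 'rV[R]_d), 0 <= t -> t <= 1 ->
    f (t *: x + (1 - t) *: y) <=
      t * f x + (1 - t) * f y - mu / 2 * t * (1 - t) * enorm (x - y) ^+ 2.

Definition favg {R : realType} {d n : nat} (f : 'I_n -> 'rV[R]_d -> R)
    (x : 'rV[R]_d) : R :=
  n%:R^-1 * \sum_(i < n) f i x.

(* [inf] is 0 on sets that are not bounded below; to be used together with
   [has_lbound (range f)]. *)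
Definition fstar {R : realType} {d : nat} (f : 'rV[R]_d -> R) : R :=
  inf (range f).

Definition sigma2 {R : realType} {d n : nat} (f : 'I_n -> 'rV[R]_d -> R)
    (xstar : 'rV[R]_d) : R :=
  n%:R^-1 * \sum_(i < n) (f i xstar - fstar (f i)).

(* The library has no notion of independence: [iid_uniform P idx] says that the
   idx k are random variables with values in the discrete space 'I_n, uniformly
   distributed, and mutually independent (product rule over every finite set of
   times). *)
Definition iid_uniform {dd : measure_display} {T : measurableType dd}
    {R : realType} (P : probability T R) {n : nat} (idx : nat -> T -> 'I_n) :
    Prop :=
  [/\ forall k (B : set 'I_n), measurable (idx k @^-1` B),
      forall k i, P (idx k @^-1` [set i]) = (n%:R^-1)%:E
    & forall (J : {fset nat}) (B : nat -> set 'I_n),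
        P (\bigcap_(k in [set` J]) idx k @^-1` B k) =
        (\prod_(k <- J) P (idx k @^-1` B k))%E].

(* [gamma i x] is the step-size used at the point x when the index i is drawn;
   [s k] is the index drawn at iteration k. *)
Fixpoint sgd {R : realType} {d n : nat} (f : 'I_n -> 'rV[R]_d -> R)
    (gamma : 'I_n -> 'rV[R]_d -> R) (x0 : 'rV[R]_d) (s : nat -> 'I_n)
    (k : nat) : 'rV[R]_d :=
  if k is m.+1 then
    let x := sgd f gamma x0 s m in
    x - gamma (s m) x *: grad (f (s m)) x
  else x0.

Definition sps_max {R : realType} {d n : nat} (f : 'I_n -> 'rV[R]_d -> R)
    (c gamma_b : R) (i : 'I_n) (x : 'rV[R]_d) : R :=
  if grad (f i) x == 0 then gamma_b
  else Num.min ((f i x - fstar (f i)) / (c * enorm (grad (f i) x) ^+ 2))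
               gamma_b.

Definition const_step {R : realType} {d n : nat} (gamma : R)
    (i : 'I_n) (x : 'rV[R]_d) : R := gamma.

(* Main.v *)
Require Import Defs.
From HB Require Import structures.
From mathcomp Require Import all_boot all_order all_algebra.
From mathcomp Require Import finmap ring lra.
From mathcomp Require Import all_classical all_reals all_analysis.
From mathcomp Require Import measurable_realfun.

Set Implicit Arguments.
Unset Strict Implicit.
Unset Printing Implicit Defensive.

Import Order.TTheory GRing.Theory Num.Theory.
Import numFieldNormedType.Exports.

Local Open Scope classical_set_scope.
Local Open Scope ring_scope.

(** Write g = grad (f i) x. The descent lemma applied at x - g / M, with M the
largest smoothness constant, gives |g|^2 <= 2 M (f_i x - f_i^* ): this is
[grad_sqr_le]. Hence the Polyak ratio with c = 1/2 is at least 1 / M >= gamma_b,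
the minimum in SPS_max is always gamma_b, and the method is SGD with constant
step gamma = gamma_b.

For that method, expand
  |x - gamma g - x^*|^2 = |x - x^*|^2 - 2 gamma <g, x - x^*> + gamma^2 |g|^2
and average over i. Strong convexity of the mean function bounds the mean of
<g, x - x^*> from below by f x - f x^* + mu/2 |x - x^*|^2, and gamma |g|^2 is at
most 2 (f_i x - f_i^* ). The values f x cancel, and what remains is the one-step
bound [transition_dist2_le]
  E_i |x - gamma g - x^*|^2 <= (1 - mu gamma) |x - x^*|^2 + 2 gamma sigma^2.
Its fixed point is 2 sigma^2 / mu, so iterating it gives the first estimate; the
second is the case sigma = 0.

Iterating needs 1 - mu gamma >= 0. The one-step bound implies this by itself: its
left-hand side is nonnegative, so a negative coefficient would be refuted by
points far from x^*. The exception is dimension 0, where all distances vanish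
([contraction_ge0]).

On the probabilistic side, independence enters only through
[expectation_iterate]: the expectation of G at the k-th iterate is the k-th power
of the operator G |-> (x |-> E_i [G (step i x)]), applied to G and evaluated at
the starting point. All estimates are then pointwise statements about this
operator. *)

(** * Euclidean inner product *)

Section Euclidean.
Variables (R : realType) (d : nat).
Implicit Types u v w : 'rV[R]_d.

Definition dotr u v : R := \sum_j u 0 j * v 0 j.

Lemma dotrC u v : dotr u v = dotr v u.
Proof. by apply: eq_bigr => j _; rewrite mulrC. Qed.

Lemma dotrDl u v w : dotr (u + v) w = dotr u w + dotr v w.
Proof. by rewrite -big_split; apply: eq_bigr => j _; rewrite mxE mulrDl. Qed.

Lemma dotrZl a u w : dotr (a *: u) w = a * dotr u w.
Proof. by rewrite mulr_sumr; apply: eq_bigr => j _; rewrite mxE mulrA. Qed.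

Lemma dotrBl u v w : dotr (u - v) w = dotr u w - dotr v w.
Proof. by rewrite -scaleN1r dotrDl dotrZl mulN1r. Qed.

Lemma dotrDr u v w : dotr w (u + v) = dotr w u + dotr w v.
Proof. by rewrite dotrC dotrDl !(dotrC _ w). Qed.

Lemma dotrZr a u w : dotr w (a *: u) = a * dotr w u.
Proof. by rewrite dotrC dotrZl dotrC. Qed.

Lemma enorm_sqr u : enorm u ^+ 2 = dotr u u.
Proof.
rewrite sqr_sqrtr; last by apply: sumr_ge0 => j _; exact: sqr_ge0.
by apply: eq_bigr => j _; rewrite expr2.
Qed.

Lemma enorm_ge0 u : 0 <= enorm u. Proof. exact: sqrtr_ge0. Qed.

Lemma enormZ_sqr a u : enorm (a *: u) ^+ 2 = a ^+ 2 * enorm u ^+ 2.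
Proof. by rewrite !enorm_sqr dotrZl dotrZr mulrA expr2. Qed.

Lemma enormB_sqr u v :
  enorm (u - v) ^+ 2 = enorm u ^+ 2 - 2 * dotr u v + enorm v ^+ 2.
Proof.
rewrite !enorm_sqr -scaleN1r dotrDl !dotrDr !dotrZl !dotrZr (dotrC v u).
ring.
Qed.

Lemma enorm0_sqr : enorm (0 : 'rV[R]_d) ^+ 2 = 0.
Proof. by rewrite -(scale0r (0 : 'rV[R]_d)) enormZ_sqr expr0n mul0r. Qed.

Lemma enorm_sqr_gt0 u : (0 < enorm u ^+ 2) = (u != 0).
Proof.
have [->|u0] := eqVneq u 0; first by rewrite enorm0_sqr ltxx.
rewrite lt_neqAle sqr_ge0 andbT eq_sym enorm_sqr psumr_eq0; last first.
  by move=> j _; rewrite -expr2 sqr_ge0.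
apply: contra u0 => /allP u0; apply/eqP/rowP => j; rewrite mxE.
by have := u0 j (mem_index_enum j); rewrite mulf_eq0 orbb => /eqP.
Qed.

(** A Cauchy-Schwarz estimate for a u already controlled by v. Expanding
0 <= |u - c v|^2 proves it without dividing by |u| or |v|. *)
Lemma dotr_le c u v : 0 < c -> enorm u <= c * enorm v ->
  dotr u v <= c * enorm v ^+ 2.
Proof.
move=> c0 ucv.
have u2 : enorm u ^+ 2 <= c ^+ 2 * enorm v ^+ 2.
  by rewrite -exprMn lerXn2r // nnegrE ?mulr_ge0 ?enorm_ge0 // ltW.
have := sqr_ge0 (enorm (u - c *: v)).
rewrite enormB_sqr dotrZr enormZ_sqr => h.
rewrite -(ler_pM2l c0); lra.
Qed.

End Euclidean.

(** * Smoothness, strong convexity and gradients *)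

Section Gradient.
Variables (R : realType) (d : nat).
Implicit Types (g : 'rV[R]_d -> R) (x v : 'rV[R]_d).

Lemma derive_grad g x v : differentiable g x -> 'D_v g x = dotr (grad g x) v.
Proof.
move=> gx; rewrite deriveE// [in LHS](row_sum_delta v) linear_sum.
apply: eq_bigr => j _; rewrite linearZ /= mxE deriveE// mulrC.
by [].
Qed.

Lemma is_derive_line g x v (t : R) : differentiable g (t *: v + x) ->
  is_derive t 1 (fun s : R => g (s *: v + x)) (dotr (grad g (t *: v + x)) v).
Proof.
move=> gx.
have E : (fun h : R => h^-1 *: (g ((h *: 1 + t) *: v + x) - g (t *: v + x)))
       = (fun h => h^-1 *: (g (h *: v + (t *: v + x)) - g (t *: v + x))).
  by apply/funext => h; rewrite scalerDl addrA -scalerA scale1r.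
rewrite -derive_grad//; split.
  rewrite /derivable /= E; exact: (@diff_derivable _ _ _ g _ v gx).
by rewrite /derive /= E.
Qed.

(** The mean value theorem on [0, 1] for
psi s = g (s v + x) - s <grad g x, v> - s^2 (L/2) |v|^2, whose derivative is
nonpositive because grad g moves by at most L s |v| between x and s v + x. *)
Lemma descent_lemma (L : R) g x v : 0 < L -> smooth L g ->
  g (v + x) <= g x + dotr (grad g x) v + L / 2 * enorm v ^+ 2.
Proof.
move=> L0 [dg lipg].
pose D := dotr (grad g x) v; pose N := enorm v ^+ 2.
pose psi (s : R) := g (s *: v + x) - (s * D + s ^+ 2 * (L / 2 * N)).
have dpsi (s : R) : is_derive s 1 psi
    (dotr (grad g (s *: v + x)) v - (D + s * (L * N))).
  have ? := is_derive_line (dg (s *: v + x)).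
  rewrite /psi; apply: is_derive_eq.
  rewrite /GRing.scale /=; by congr (_ - _); field.
have cpsi : continuous psi.
  move=> r.
  apply: differentiable_continuous; apply/derivable1_diffP.
  by have [] := dpsi r.
have [c c01] := MVT ltr01 (fun s _ => dpsi s) (continuous_subspaceT cpsi).
rewrite subr0 mulr1 /psi scale1r scale0r add0r mul1r mul0r expr0n mul0r expr1n.
rewrite mul1r addr0 subr0 => E.
have c0 : 0 < c by move: c01; rewrite in_itv /= => /andP[].
suff : dotr (grad g (c *: v + x)) v - D <= c * L * N.
  by rewrite /D in E *; rewrite -/N; lra.
rewrite -dotrBl; apply: dotr_le; first exact: mulr_gt0.
apply: le_trans (lipg _ _) _; rewrite addrK mulrC.
have -> : enorm (c *: v) = c * enorm v.
  apply/eqP; rewrite -(@eqrXn2 _ 2) ?mulr_ge0 ?enorm_ge0 ?(ltW c0)//.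
  by rewrite enormZ_sqr exprMn.
by rewrite mulrAC.
Qed.

Lemma smooth_le (L M : R) g : L <= M -> smooth L g -> smooth M g.
Proof.
move=> LM [dg lipg]; split=> // x y.
by apply: le_trans (lipg x y) _; rewrite ler_wpM2r ?enorm_ge0.
Qed.

Lemma fstar_le g x : has_lbound (range g) -> fstar g <= g x.
Proof. by move=> gb; apply: ge_inf => //; exists x. Qed.

(** The step v = - grad g x / L minimizes the upper bound of the descent lemma, and
g cannot go below its infimum there. *)
Lemma grad_sqr_le (L : R) g x : 0 < L -> smooth L g -> has_lbound (range g) ->
  enorm (grad g x) ^+ 2 <= 2 * L * (g x - fstar g).
Proof.
move=> L0 Lg gb; set G := grad g x.
have := le_trans (fstar_le (- L^-1 *: G + x) gb)
  (descent_lemma x (- L^-1 *: G) L0 Lg).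
rewrite dotrZr -enorm_sqr enormZ_sqr -/G => h.
have E : L / 2 * ((- L^-1) ^+ 2 * enorm G ^+ 2) = L^-1 / 2 * enorm G ^+ 2.
  by field; rewrite gt_eqF.
rewrite {}E in h.
have {h}h : L^-1 / 2 * enorm G ^+ 2 <= g x - fstar g by lra.
rewrite (_ : 2 * L = (L^-1 / 2)^-1); last by field; rewrite gt_eqF.
by rewrite -ler_pdivrMl ?invrK// invr_gt0 divr_gt0// invr_gt0.
Qed.

(** Divide the strong convexity inequality at h y + (1 - h) x by h > 0; the
difference quotient tends to the directional derivative as h tends to 0. *)
Lemma derive_strongly_convex (mu : R) g x y : strongly_convex mu g ->
  derivable g x (y - x) ->
  'D_(y - x) g x <= g y - g x - mu / 2 * enorm (y - x) ^+ 2.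
Proof.
move=> sc dg; set v := y - x.
pose B (h : R) := g y - g x - mu / 2 * (1 - h) * enorm v ^+ 2.
have cB : B h @[h --> 0^'+] --> B 0.
  apply: cvg_at_right_filter.
  apply: cvgB; first exact: cvg_cst.
  apply: cvgM; last exact: cvg_cst.
  apply: cvgM; first exact: cvg_cst.
  by apply: cvgB; [exact: cvg_cst|exact: cvg_id].
have -> : g y - g x - mu / 2 * enorm v ^+ 2 = B 0 by rewrite /B subr0 mulr1.
apply: ler_cvg_to (cvg_dnbhs_at_right dg) cB _.
near=> h.
have h0 : 0 < h by near: h; exact: nbhs_right_gt.
have h1 : h <= 1 by near: h; exact: nbhs_right_le.
have := sc h y x (ltW h0) h1.
have -> : h *: y + (1 - h) *: x = h *: v + x.
  by rewrite scalerBl scale1r /v scalerBr addrA addrAC.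
rewrite -/v => hh.
rewrite /GRing.scale /= ler_pdivrMl// /B; lra.
Unshelve. all: by end_near. Qed.

End Gradient.

(** * Iterations driven by independent uniform indices *)

Section RandomIteration.
Variables (R : realType) (n : nat) (V : Type) (step : 'I_n -> V -> V).
Implicit Types (G : V -> R) (x : V).

(** The Markov operator of the chain that moves from x to [step i x] with i
uniform. *)
Definition transition G x : R := n%:R^-1 * \sum_(i < n) G (step i x).

Lemma iter_transition_sum k (c : R) (G : 'I_n -> V -> R) x :
  iter k transition (fun y => c * \sum_(i < n) G i y) x =
  c * \sum_(i < n) iter k transition (G i) x.
Proof.
elim: k x => [//|k IHk] x; rewrite !iterS /transition.
under eq_bigr do rewrite IHk.
rewrite -mulr_sumr exchange_big /= mulrCA; congr (_ * _).
by rewrite mulr_sumr.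
Qed.

Lemma iter_transition_ge0 k G x : (forall y, 0 <= G y) ->
  0 <= iter k transition G x.
Proof.
move=> G0; elim: k x => [//|k IHk] x; rewrite iterS.
by rewrite mulr_ge0 ?invr_ge0 ?ler0n// sumr_ge0.
Qed.

(** The drift is written with (1 - a) * c so that c is its fixed point; the bound
then propagates exactly, with weights a ^+ k and 1 - a ^+ k. *)
Lemma iter_transition_le (a c : R) G : (0 < n)%N -> 0 <= a ->
  (forall x, transition G x <= a * G x + (1 - a) * c) ->
  forall k x, iter k transition G x <= a ^+ k * G x + (1 - a ^+ k) * c.
Proof.
move=> n0 a0 drift; elim=> [|k IHk] x.
  by rewrite expr0 subrr mul0r addr0 mul1r.
rewrite iterS.
have nz : n%:R != 0 :> R by rewrite pnatr_eq0 -lt0n.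
apply: (@le_trans _ _ (a ^+ k * transition G x + (1 - a ^+ k) * c)).
  rewrite [X in X <= _]/transition.
  have -> : a ^+ k * transition G x + (1 - a ^+ k) * c
      = n%:R^-1 * \sum_(i < n) (a ^+ k * G (step i x) + (1 - a ^+ k) * c).
    rewrite big_split /= sumr_const card_ord -mulr_sumr mulrDr.
    rewrite -[((1 - a ^+ k) * c) *+ n]mulr_natl mulKf//.
    by rewrite mulrCA.
  by rewrite ler_pM2l ?invr_gt0 ?ltr0n//; apply: ler_sum => i _; exact: IHk.
have := ler_wpM2l (exprn_ge0 k a0) (drift x); rewrite exprSr; lra.
Qed.

Variables (dd : measure_display) (Omega : measurableType dd).
Variables (P : probability Omega R) (idx : nat -> Omega -> 'I_n).
Variables (x0 : V) (X : nat -> Omega -> V).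
Hypothesis iid : iid_uniform P idx.
Hypothesis X0 : forall w, X 0 w = x0.
Hypothesis XS : forall k w, X k.+1 w = step (idx k w) (X k w).

Let cylinder (J : {fset nat}) (B : nat -> set 'I_n) : set Omega :=
  \bigcap_(j in [set` J]) idx j @^-1` B j.

Let measurable_cylinder J B : measurable (cylinder J B).
Proof.
case: iid => midx _ _; rewrite /cylinder bigcap_fset.
by apply: bigsetI_measurable => j _; exact: midx.
Qed.

(** Prescribing the index at one further time k gives an event of the same form,
and the product rule makes it n times less likely. *)
Lemma cylinder_refine (J : {fset nat}) B k i : k \notin J ->
  exists B', idx k @^-1` [set i] `&` cylinder J B = cylinder (k |` J)%fset B' /\
    P (cylinder (k |` J)%fset B') = ((n%:R^-1)%:E * P (cylinder J B))%E.
Proof.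
move=> kJ; case: iid => _ unif indep.
pose B' j := if j == k then [set i] else B j.
have B'J j : j \in J -> B' j = B j.
  by move=> jJ; rewrite /B'; case: eqVneq jJ kJ => // -> ->.
exists B'; split.
  rewrite /cylinder set_fsetU1 bigcap_setU1 {1}/B' eqxx; congr (_ `&` _).
  by apply: eq_bigcapr => j jJ; rewrite B'J.
rewrite /cylinder !indep big_fsetU1//= {1}/B' eqxx unif; congr (_ * _)%E.
by apply: eq_big_seq => j jJ; rewrite B'J.
Qed.

(** G is arbitrary because the k-th iterate takes finitely many values, each on an
event determined by the first k indices. *)
Lemma measurable_iterate G k : measurable_fun setT (fun w => G (X k w)).
Proof.
case: iid => midx _ _.
elim: k G => [|k IHk] G.
  by under eq_fun do rewrite X0; exact: measurable_cst.
have -> : (fun w => G (X k.+1 w)) = (fun w => \sum_(i < n)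
    (\1_(idx k @^-1` [set i]) w * G (step i (X k w)))).
  apply/funext => w; rewrite (bigD1 (idx k w)) //= big1 ?addr0.
    by rewrite indicE mem_set// mul1r XS.
  move=> i /eqP ik; rewrite indicE memNset ?mul0r// => /= E.
  by apply: ik; rewrite E.
apply: measurable_sum => i; apply: measurable_funM.
  by apply: measurable_indic; exact: midx.
exact: (IHk (G \o step i)).
Qed.

(** Integrating over events that constrain only the indices drawn from time k on
is what makes the induction go through: splitting according to the value of the
k-th index turns the iterate k+1 into the iterate k, at the price of one more
constraint, at time k. *)
Lemma integral_cylinder_iterate k J B G : (forall x, 0 <= G x) ->
  (forall j, j \in J -> (k <= j)%N) ->
  (\int[P]_(w in cylinder J B) (G (X k w))%:E =
   (iter k transition G x0)%:E * P (cylinder J B))%E.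
Proof.
elim: k J B G => [|k IHk] J B G G0 leJ.
  under eq_integral do rewrite X0.
  by rewrite integral_cst.
have kJ : k \notin J by apply/negP => /leJ; rewrite ltnn.
pose A i := idx k @^-1` [set i] `&` cylinder J B.
have AE : cylinder J B = \big[setU/set0]_(i <- enum 'I_n) A i.
  rewrite -bigcup_seq; apply/seteqP; split => [w Jw|w [i _ []]//].
  by exists (idx k w) => //=; rewrite mem_enum.
rewrite {1}AE ge0_integral_bigsetU /=.
- have intA i : (\int[P]_(w in A i) (G (X k.+1 w))%:E = (n%:R^-1 *
      iter k transition (G \o step i) x0)%:E * P (cylinder J B))%E.
    have [B' [AiE PAi]] := cylinder_refine B i kJ.
    transitivity (\int[P]_(w in A i) ((G \o step i) (X k w))%:E)%E.
      by apply: eq_integral => w /set_mem[] /= <- _; rewrite XS.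
    rewrite /A AiE IHk ?PAi.
    - by rewrite EFinM muleA [X in (X * _)%E]muleC.
    - by move=> x; exact: G0.
    - by move=> j; rewrite !inE => /predU1P[->//|/leJ /ltnW].
  rewrite (eq_bigr _ (fun i _ => intA i)) big_enum /=.
  have finP : P (cylinder J B) \is a fin_num by exact: fin_num_measure.
  rewrite -(fineK finP); under eq_bigr do rewrite -EFinM.
  rewrite sumEFin -EFinM; congr EFin; rewrite -mulr_suml; congr (_ * _).
  rewrite -mulr_sumr -iterS iterSr; apply/esym.
  exact: (iter_transition_sum k _ (fun i => G \o step i)).
- move=> i; apply: measurableI => //; by case: iid => + _ _; exact.
- exact: enum_uniq.
- by move=> i j _ _ [w [[/= <- _] [<- _]]].
- apply/measurable_EFinP.
  exact: measurable_funS (measurable_iterate G k.+1).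
- by move=> w _; rewrite lee_fin.
Qed.

Lemma expectation_iterate k G : (forall x, 0 <= G x) ->
  ('E_P[fun w => G (X k w)] = (iter k transition G x0)%:E)%E.
Proof.
move=> G0.
have := @integral_cylinder_iterate k fset0 (fun=> setT) G G0.
rewrite /cylinder set_fset0 bigcap_set0 probability_setT mule1 => h.
by rewrite unlock h.
Qed.

End RandomIteration.

(** * SGD with a constant step-size *)

Section ConstantStep.
Variables (R : realType) (d n : nat) (f : 'I_n -> 'rV[R]_d -> R).
Variables (M gamma : R).
Hypotheses (M0 : 0 < M) (gamma0 : 0 < gamma) (gammaM : gamma <= M^-1).
Hypothesis fM : forall i, smooth M (f i).
Hypothesis fbounded : forall i, has_lbound (range (f i)).

Lemma step_grad_sqr_le i x :
  gamma * enorm (grad (f i) x) ^+ 2 <= 2 * (f i x - fstar (f i)).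
Proof.
apply: (@le_trans _ _ (M^-1 * enorm (grad (f i) x) ^+ 2)).
  by rewrite ler_wpM2r ?sqr_ge0.
by rewrite ler_pdivrMl// mulrA (mulrC M) grad_sqr_le.
Qed.

Lemma sps_max_half i x : sps_max f (1 / 2) gamma i x = gamma.
Proof.
rewrite /sps_max; case: eqVneq => // g0; apply/min_idPr.
rewrite ler_pdivlMr; last by rewrite mulr_gt0 ?enorm_sqr_gt0.
have := step_grad_sqr_le i x; lra.
Qed.

Variables (mu : R) (xstar : 'rV[R]_d).
Hypotheses (n0 : (0 < n)%N) (mu0 : 0 < mu).
Hypothesis fmu : strongly_convex mu (favg f).

Let dist2 (x : 'rV[R]_d) := enorm (x - xstar) ^+ 2.
Let step i x := x - gamma *: grad (f i) x.

Lemma sigma2_ge0 : 0 <= sigma2 f xstar.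
Proof.
rewrite mulr_ge0 ?invr_ge0 ?ler0n// sumr_ge0// => i _.
by rewrite subr_ge0 fstar_le.
Qed.

(** The average of the inner products is minus the derivative of the mean function
in the direction xstar - x, to which strong convexity applies. *)
Lemma mean_gradient_le x :
  favg f x - favg f xstar + mu / 2 * dist2 x <=
  n%:R^-1 * \sum_(i < n) dotr (grad (f i) x) (x - xstar).
Proof.
have df i : derivable (f i) x (xstar - x).
  by apply: diff_derivable; have [] := fM i.
have favgE : favg f = n%:R^-1 \*: (\sum_(i < n) f i).
  by apply/funext => y; rewrite /favg /= fct_sumE.
have := @derive_strongly_convex _ _ mu (favg f) x xstar fmu.
rewrite favgE deriveZ; last exact: derivable_sum.
rewrite derive_sum// -favgE => /(_ _)/wrap[].
  by rewrite favgE; apply: derivableZ; exact: derivable_sum.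
have -> : xstar - x = -1 *: (x - xstar) by rewrite scaleN1r opprB.
rewrite enormZ_sqr sqrrN expr1n mul1r -/(dist2 x) => h.
have -> : n%:R^-1 * (\sum_(i < n) dotr (grad (f i) x) (x - xstar)) =
  - (n%:R^-1 *: \sum_(i < n) 'D_(-1 *: (x - xstar)) (f i) x).
  rewrite /GRing.scale /= -mulrN -sumrN; congr (_ * _); apply: eq_bigr => i _.
  by rewrite derive_grad ?dotrZr ?mulN1r ?opprK//; have [] := fM i.
lra.
Qed.

Lemma transition_dist2_le x : transition step dist2 x <=
  (1 - mu * gamma) * dist2 x + 2 * gamma * sigma2 f xstar.
Proof.
have nz : n%:R != 0 :> R by rewrite pnatr_eq0 -lt0n.
have stepE i : dist2 (step i x) <= dist2 x
    - 2 * gamma * dotr (grad (f i) x) (x - xstar)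
    + 2 * gamma * (f i x - fstar (f i)).
  rewrite [X in X <= _]/dist2 /step (addrAC x) enormB_sqr -/(dist2 x).
  rewrite dotrZr enormZ_sqr dotrC.
  have := ler_wpM2l (ltW gamma0) (step_grad_sqr_le i x).
  lra.
apply: (@le_trans _ _ (n%:R^-1 * \sum_(i < n) (dist2 x
    - 2 * gamma * dotr (grad (f i) x) (x - xstar)
    + 2 * gamma * (f i x - fstar (f i))))).
  by rewrite ler_pM2l ?invr_gt0 ?ltr0n//; apply: ler_sum.
rewrite big_split /= sumrB sumr_const card_ord -[dist2 x *+ n]mulr_natl.
rewrite -!mulr_sumr sumrB.
have := ler_wpM2l (ltW gamma0) (mean_gradient_le x).
rewrite /sigma2 sumrB /favg.
set S := \sum_(i < n) dotr _ _; set F := \sum_(i < n) f i x.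
set F' := \sum_(i < n) fstar _; set F0 := \sum_(i < n) f i xstar => h.
rewrite !(mulrDr, mulrBr) mulKf//; lra.
Qed.

(** If 1 - mu gamma < 0 and x differs from xstar, then on the ray from xstar
through x the right-hand side of [transition_dist2_le] becomes negative far away
from xstar, while its left-hand side is an average of squares. The second
alternative is dimension 0. *)
Lemma contraction_ge0 : 0 <= 1 - mu * gamma \/ forall x, dist2 x = 0.
Proof.
have [a0|a0] := leP 0 (1 - mu * gamma); [by left|right => x].
apply/eqP/negPn/negP => x0.
have dx : 0 < dist2 x by rewrite lt_neqAle eq_sym x0 sqr_ge0.
set b := 2 * gamma * sigma2 f xstar.
have b0 : 0 <= b by apply: mulr_ge0 sigma2_ge0; rewrite mulr_ge0// ltW.
set q := (mu * gamma - 1) * dist2 x.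
have q0 : 0 < q by rewrite mulr_gt0//; lra.
(* The right-hand side at xstar + t (x - xstar) is b - t^2 q; this t satisfies
   t >= 1 and t q > b, so t^2 q > b. *)
pose t := 1 + b / q.
have t1 : 1 <= t by rewrite lerDl divr_ge0// ltW.
have tq : t * q = q + b by rewrite /t mulrDl mul1r divfK// gt_eqF.
pose y := t *: (x - xstar) + xstar.
have dy : dist2 y = t ^+ 2 * dist2 x by rewrite /dist2 /y addrK enormZ_sqr.
have := transition_dist2_le y; rewrite dy -/b.
have : 0 <= transition step dist2 y.
  by apply: (@iter_transition_ge0 _ _ _ step 1) => z; exact: sqr_ge0.
have : t * q <= t ^+ 2 * q.
  by rewrite ler_pM2r// expr2 ler_peMl// (le_trans _ t1).
have -> : (1 - mu * gamma) * (t ^+ 2 * dist2 x) = - (t ^+ 2 * q).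
  by rewrite /q; ring.
lra.
Qed.

Lemma iter_transition_dist2_le k x : iter k (transition step) dist2 x <=
  (1 - mu * gamma) ^+ k * dist2 x + 2 * sigma2 f xstar / mu.
Proof.
set c := 2 * sigma2 f xstar / mu.
have c0 : 0 <= c by apply: divr_ge0 (ltW mu0); apply: mulr_ge0 sigma2_ge0.
have cE : mu * gamma * c = 2 * gamma * sigma2 f xstar.
  by rewrite /c; field; rewrite gt_eqF.
have [a0|dist0] := contraction_ge0.
  apply: (le_trans (iter_transition_le (c := c) n0 a0 _ k x)) => [y|].
    by rewrite subKr cE transition_dist2_le.
  by rewrite lerD2l ler_piMl// gerBl exprn_ge0.
(* In dimension 0 the sign of (1 - mu * gamma) ^+ k is unknown, but it multiplies
   a zero distance. *)
have -> : iter k (transition step) dist2 x = 0.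
  elim: k x => [//|k IHk] x.
  by rewrite iterS /transition big1 ?mulr0// => i _; exact: IHk.
by rewrite dist0 mulr0 add0r.
Qed.

End ConstantStep.

(** * The convergence theorem *)

Theorem corollary3p3 (R : realType) (d n : nat) (hn : (0 < n)%N)
    (f : 'I_n -> 'rV[R]_d -> R) (L : 'I_n -> R) (mu gamma_b : R)
    (xstar x0 : 'rV[R]_d)
    (dd : measure_display) (Omega : measurableType dd) (P : probability Omega R)
    (idx : nat -> Omega -> 'I_n)
    (hidx : iid_uniform P idx)
    (hconvex : forall i, convex_function [set: 'rV[R]_d] (f i))
    (hL : forall i, 0 <= L i)
    (hsmooth : forall i, smooth (L i) (f i))
    (hfstar : forall i, has_lbound (range (f i)))
    (hmu : 0 < mu)
    (hstrong : strongly_convex mu (favg f))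
    (hmin : forall y, favg f xstar <= favg f y)
    (hgamma0 : 0 < gamma_b)
    (hgamma : gamma_b <= 1 / \big[Num.max/0]_(i < n) L i) :
  let x_sps k w := sgd f (sps_max f (1 / 2) gamma_b) x0 (idx^~ w) k in
  let x_const k w := sgd f (const_step gamma_b) x0 (idx^~ w) k in
  [/\ forall k w, sps_max f (1 / 2) gamma_b (idx k w) (x_sps k w) = gamma_b,
      forall k w, x_sps k w = x_const k w,
      forall k,
        ('E_P[(fun w => enorm (x_sps k w - xstar) ^+ 2)%R] <=
         ((1 - mu * gamma_b) ^+ k * enorm (x0 - xstar) ^+ 2 +
          2 * sigma2 f xstar / mu)%R%:E)%E
    & sigma2 f xstar = 0 ->
      forall k,
        ('E_P[(fun w => enorm (x_const k w - xstar) ^+ 2)%R] <=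
         ((1 - mu * gamma_b) ^+ k * enorm (x0 - xstar) ^+ 2)%R%:E)%E].
Proof.
move=> x_sps x_const.
set M := \big[Num.max/0]_(i < n) L i; rewrite -/M div1r in hgamma.
(* If M were 0, then M^-1 = 0 would contradict 0 < gamma_b <= M^-1. *)
have M0 : 0 < M by rewrite -invr_gt0 (lt_le_trans hgamma0).
have smoothM i : smooth M (f i).
  by apply: smooth_le (hsmooth i); exact: le_bigmax_cond.
have sps_gamma := sps_max_half M0 hgamma smoothM hfstar.
have sps_const k w : x_sps k w = x_const k w.
  elim: k => [//|k IHk].
  by rewrite /x_sps /x_const /= -/(x_sps k w) -/(x_const k w) IHk sps_gamma.
have bound k : ('E_P[(fun w => enorm (x_const k w - xstar) ^+ 2)%R] <=
    ((1 - mu * gamma_b) ^+ k * enorm (x0 - xstar) ^+ 2 +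
      2 * sigma2 f xstar / mu)%R%:E)%E.
  rewrite (@expectation_iterate _ _ _ (fun i x => x - gamma_b *: grad (f i) x)
    _ _ P idx x0 x_const hidx _ _ k (fun x => enorm (x - xstar) ^+ 2))//.
    by rewrite lee_fin; exact: (iter_transition_dist2_le M0).
  by move=> x; exact: sqr_ge0.
split=> [k w|//|k|sigma0 k]; first exact: sps_gamma.
  by under eq_fun do rewrite sps_const.
by have := bound k; rewrite sigma0 mulr0 mul0r addr0.
Qed.
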